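(* Let $G$ and $H$ be finite simple graphs, each having at least one edge. If the lexicographic product $G\circ H$ is well-f-covered, then: (1) $G$ is well-covered; and if every maximal forest of $G$ has no isolated vertex and $H$ has a maximal independent set of size $1$, then $G$ is well-f-covered and $f(G)=f(G\circ H)$; (2) $H$ is well-f-covered; and if $G$ has a maximal forest with at least one leaf, then $H$ is well-covered; (3) $f(G\circ H)=\alpha(G)\,f(H)$; (4) for every maximal forest $F$ of $G$ and every maximal independent set $M_H$ of $H$, \[f(H)\,I(F)+|M_H|\bigl(K_{2}(F)+L(F)\bigr)+K_{2}(F)+L'(F)=f(G\circ H),\] where $I(F)$ is the number of isolated vertices of $F$, $K_{2}(F)$ is the number of connected components of $F$ isomorphic to $K_{2}$, $L(F)$ is the number of leaves (vertices of degree $1$) lying in components of $F$ that are not isomorphic to $K_2$, and $L'(F)$ is the number of vertices of degree at least $2$ in $F$.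
   Context: All graphs are finite and simple. The lexicographic product $G\circ H$ has vertex set $V(G)\times V(H)$, with $(g,h)$ adjacent to $(g',h')$ if and only if either $g$ is adjacent to $g'$ in $G$, or $g=g'$ and $h$ is adjacent to $h'$ in $H$. A forest in a graph $G$ means an induced subgraph $G[X]$ ($X\subseteq V(G)$) containing no cycle; it is a maximal forest if no vertex set properly containing $X$ induces an acyclic subgraph. The forest number $f(G)$ is the maximum order of a forest in $G$. A graph is well-f-covered if all its maximal forests have the same order (necessarily $f(G)$). A leaf of a forest is a vertex of degree $1$ in it. $\alpha(G)$ denotes the independence number of $G$, and $G$ is well-covered if all its maximal independent sets have the same size. *)

(* Defs.v *)
From mathcomp Require Import all_boot.
Set Implicit Arguments.
Unset Strict Implicit.
Unset Printing Implicit Defensive.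

Record sgraph := SGraph {
  vertex :> finType;
  adj : rel vertex;
  adj_sym : symmetric adj;
  adj_irr : irreflexive adj }.

Definition has_edge (G : sgraph) : Prop := exists x y : G, adj x y.

Section Lex.
Variables G H : sgraph.

Definition lex_adj : rel (G * H) :=
  fun p q => adj p.1 q.1 || (p.1 == q.1) && adj p.2 q.2.

Lemma lex_adj_sym : symmetric lex_adj.
Proof.
by move=> p q; rewrite /lex_adj adj_sym eq_sym (adj_sym p.2).
Qed.

Lemma lex_adj_irr : irreflexive lex_adj.
Proof. by move=> p; rewrite /lex_adj !adj_irr andbF. Qed.

Definition lex : sgraph := SGraph lex_adj_sym lex_adj_irr.
End Lex.

Section Induced.
Variables (G : sgraph) (X : {set G}).

Definition induced_adj : rel {x : G | x \in X} :=
  fun u v => adj (val u) (val v).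

Lemma induced_adj_sym : symmetric induced_adj.
Proof. by move=> u v; rewrite /induced_adj adj_sym. Qed.

Lemma induced_adj_irr : irreflexive induced_adj.
Proof. by move=> u; rewrite /induced_adj adj_irr. Qed.

Definition induced : sgraph := SGraph induced_adj_sym induced_adj_irr.
End Induced.

Section Complete.
Variable n : nat.

Definition complete_adj : rel 'I_n := fun i j => i != j.

Lemma complete_adj_sym : symmetric complete_adj.
Proof. by move=> i j; rewrite /complete_adj eq_sym. Qed.

Lemma complete_adj_irr : irreflexive complete_adj.
Proof. by move=> i; rewrite /complete_adj eqxx. Qed.

Definition complete : sgraph := SGraph complete_adj_sym complete_adj_irr.
End Complete.

Definition isomorphic (G H : sgraph) : bool :=
  [exists f : {ffun G -> H},
    [&& injectiveb f, [forall y, y \in codom f]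
      & [forall x, forall y, adj (f x) (f y) == adj x y]]].

Definition acyclic (G : sgraph) : bool :=
  [forall n : 'I_#|G|.+1, forall c : n.-tuple G,
    (2 < n) ==> ~~ ucycleb (@adj G) c].

(* The upper bound on the length only makes [acyclic] decidable; the condition
   [2 < n] excludes [:: x; y], which is a [ucycle] whenever x and y are adjacent. *)
Lemma acyclicP (G : sgraph) :
  reflect (forall c : seq G, 2 < size c -> ~ ucycle (@adj G) c) (acyclic G).
Proof.
apply: (iffP idP) => [/forallP acG c c2 cC | acG].
  have cn : size c < #|G|.+1.
    by rewrite ltnS; have [_ /card_uniqP <-] := andP cC; apply: max_card.
  have /forallP/(_ (in_tuple c))/implyP/(_ c2)/negP := acG (Ordinal cn).
  by apply.
apply/forallP => n; apply/forallP => c; apply/implyP => n2; apply/negP.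
by apply: acG; rewrite size_tuple.
Qed.

Section Invariants.
Variable G : sgraph.
Implicit Types X : {set G}.

Definition forest X : bool := acyclic (induced X).
Definition max_forest X : bool := maxset forest X.
Definition forest_number : nat := \max_(X : {set G} | forest X) #|X|.
Definition well_f_covered : Prop :=
  forall X Y : {set G}, max_forest X -> max_forest Y -> #|X| = #|Y|.

Definition independent X : bool :=
  [forall x in X, forall y in X, ~~ adj x y].
Definition max_independent X : bool := maxset independent X.
Definition alpha : nat := \max_(X : {set G} | independent X) #|X|.
Definition well_covered : Prop :=
  forall X Y : {set G}, max_independent X -> max_independent Y -> #|X| = #|Y|.

Definition degree (x : G) : nat := #|[set y | adj x y]|.
Definition isolated (x : G) : bool := degree x == 0.
Definition leaf (x : G) : bool := degree x == 1.

Definition component (x : G) : {set G} := [set y | connect (@adj G) x y].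
Definition components : {set {set G}} := [set component x | x : G].
Definition is_K2 (C : {set G}) : bool := isomorphic (induced C) (complete 2).

Definition num_isolated : nat := #|[set x : G | isolated x]|.
Definition num_K2 : nat := #|[set C in components | is_K2 C]|.
Definition num_leaves : nat :=
  #|[set x : G | leaf x && ~~ is_K2 (component x)]|.
Definition num_inner : nat := #|[set x : G | 2 <= degree x]|.
End Invariants.

(* Main.v *)
Require Import Defs.
From mathcomp Require Import all_boot.
Set Implicit Arguments.
Unset Strict Implicit.
Unset Printing Implicit Defensive.

(* A set induces a forest iff it contains no nonempty set Y in which every vertex
   has two neighbours, so forests can be handled without manipulating cycles.

   Two families of maximal forests of the lexicographic product are exhibited.
   If A is a maximal independent set of G and F_H a maximal forest of H, then
   A x F_H is one.  If F is a maximal forest of G, M a maximal independent set of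
   H and h0 is in M, then one gets another by putting over an isolated vertex of
   F a copy of F_H, over a leaf of F a copy of M (but over only one of the two
   leaves of a K2 component), and over every other vertex of F the point h0.
   Comparing the cardinals of these forests gives all the claims. *)

(** * Forests and sets of minimum degree two *)

Section MinDegreeTwo.
Variable G : sgraph.
Implicit Types (X Y Z : {set G}) (c p : seq G).

Definition mindeg2 Y : bool :=
  [forall y in Y, 1 < #|[set z in Y | adj y z]|].

Lemma mindeg2P Y :
  reflect (forall y, y \in Y -> exists z1 z2,
             [/\ z1 \in Y, z2 \in Y, z1 != z2, adj y z1 & adj y z2])
          (mindeg2 Y).
Proof.
apply: (iffP forall_inP) => Y2 y /Y2 => [/card_gt1P|] [z1 [z2]].
  by rewrite !inE => -[/andP[z1Y yz1] /andP[z2Y yz2] z12]; exists z1, z2.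
move=> [z1Y z2Y z12 yz1 yz2]; apply/card_gt1P; exists z1, z2.
by rewrite !inE z1Y z2Y yz1 yz2.
Qed.

Lemma forest_ucycleP X :
  reflect (forall c, {subset c <= X} -> 2 < size c -> ~ ucycle (@adj G) c)
          (forest X).
Proof.
apply: (iffP (acyclicP _)) => [acX c cX c2 /andP[cc cU] | acX c c2 /andP[cc cU]].
  have [d dE] : {d : seq (induced X) | c = map val d}.
    by apply: all_sigP; apply/allP => x /cX.
  rewrite {}dE size_map in c2 cc cU *.
  apply: (acX d c2); apply/andP; split; last exact: map_uniq cU.
  by move: cc; rewrite cycle_map.
apply: (acX (map val c)).
- by move=> _ /mapP[x _ ->]; apply: (valP x).
- by rewrite size_map.
- apply/andP; split; last by rewrite map_inj_uniq //; apply: val_inj.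
  by rewrite cycle_map.
Qed.

(** Once the cycle is rotated to start at [y], the successor of [y] and the last vertex are its two
    neighbours. They differ because the cycle has at least three vertices. *)
Lemma ucycle_mindeg2 c :
  2 < size c -> ucycle (@adj G) c -> mindeg2 [set x in c].
Proof.
move=> c2 cC; apply/mindeg2P => y; rewrite inE => yc.
have [i p cE] := rot_to yc.
have memc : forall x, x \in y :: p -> x \in [set x in c].
  by move=> x xp; rewrite inE -(mem_rot i) cE.
have /andP[] : ucycle (@adj G) (y :: p).
  by rewrite -cE rot_ucycle.
have : 1 < size p by move: c2; rewrite -(size_rot i) cE.
case: p {cE} memc => [|a] // p; case/lastP: p => [|p b] //= memc _.
rewrite rcons_path last_rcons => /andP[ya /andP[_ b_y]] /and3P[_ aU _].
exists a, b; split=> //.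
- by apply: memc; rewrite !inE eqxx orbT.
- by apply: memc; rewrite !inE mem_rcons inE eqxx !orbT.
- by apply: contraNneq aU => ->; rewrite mem_rcons inE eqxx.
- by rewrite adj_sym.
Qed.

(* A path in Y that does not close up into a cycle can be prolonged at its
   first vertex, so it would eventually be longer than #|G|. *)
Lemma mindeg2_ucycle Y : mindeg2 Y -> Y != set0 ->
  exists c, [/\ {subset c <= Y}, 2 < size c & ucycle (@adj G) c].
Proof.
move=> /mindeg2P Y2 /set0Pn[y0 y0Y].
suff ext n : (exists c, [/\ {subset c <= Y}, 2 < size c & ucycle (@adj G) c])
    \/ exists x p, [/\ {subset x :: p <= Y}, size p = n, uniq (x :: p)
                     & path (@adj G) x p].
  have [//|[x [p [_ pn pU _]]]] := ext #|G|.
  by have := max_card (mem (x :: p)); rewrite (card_uniqP pU) /= pn ltnn.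
elim: n => [|n [|[x [p [pY pn pU pP]]]]]; [right| by left |].
  by exists y0, [::]; split=> // x; rewrite inE => /eqP->.
have xY : x \in Y by apply: pY; rewrite inE eqxx.
(* Either the path is prolonged by a neighbour of [x] in [Y] off the path, or every neighbour of [x]
   in [Y] lies on [p]. *)
have [[z [zY xz zp]]|noz] :
    (exists z, [/\ z \in Y, adj x z & z \notin x :: p]) \/
    (forall z, z \in Y -> adj x z -> z \in p).
  have [/existsP[z /and3P[]]|/existsPn noz] :=
      boolP [exists z, [&& z \in Y, adj x z & z \notin x :: p]].
    by left; exists z.
  right=> z zY xz; have := noz z; rewrite zY xz /= negbK inE.
  by case/orP=> // /eqP zx; rewrite zx adj_irr in xz.
- right; exists z, (x :: p); split=> //=.
  + by move=> v; rewrite inE => /predU1P[->|/pY].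
  + by rewrite pn.
  + by rewrite zp.
  + by rewrite adj_sym xz.
left.
have [z1 [z2 [z1Y z2Y z12 xz1 xz2]]] := Y2 x xY.
(* Of two distinct neighbours on [p], one is not the first vertex of [p]. Closing the path there
   gives a cycle of length at least three. *)
have [z [xz zp zh]] : exists z, [/\ adj x z, z \in p & z != head x p].
  have [z1h|z1h] := eqVneq z1 (head x p).
    by exists z2; split=> //; [apply: noz | rewrite -z1h eq_sym].
  by exists z1; split=> //; apply: noz.
case/splitPr: zp pY pU pP zh {pn noz} => p1 p2.
case: p1 => [|a p1]; first by rewrite /= eqxx.
move=> pY pU pP _; exists (x :: a :: rcons p1 z); split.
- move=> v vp; apply: pY; move: vp.
  rewrite !inE mem_rcons mem_cat !inE.
  by case/or4P=> ->; rewrite ?orbT.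
- by rewrite /= size_rcons.
- apply/andP; split.
    move: pP; rewrite /= cat_path /= => /and3P[-> p1P /andP[lz _]].
    by rewrite /= !rcons_path last_rcons p1P lz adj_sym xz.
  move: pU; rewrite -[x :: _]/((x :: a :: p1) ++ z :: p2) -cat_rcons cat_uniq.
  by case/andP.
Qed.

Lemma forestPn X :
  reflect (exists Y, [/\ Y \subset X, mindeg2 Y & Y != set0]) (~~ forest X).
Proof.
apply: (iffP idP) => [|[Y [YX Y2 /(mindeg2_ucycle Y2)[c [cY c2 cC]]]]].
  have [/existsP[Y /and3P[YX Y2 Y0]]|/existsPn noY] :=
      boolP [exists Y : {set G}, [&& Y \subset X, mindeg2 Y & Y != set0]].
    by exists Y.
  case/negP; apply/forest_ucycleP => c cX c2 cC.
  have := noY [set x in c]; rewrite ucycle_mindeg2 //= => /nandP[/negP|].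
    by apply; apply/subsetP => x; rewrite inE => /cX.
  case: c c2 {cC cX} => // x c _ /negPn/eqP/setP/(_ x).
  by rewrite !inE eqxx.
by apply/negP => /forest_ucycleP/(_ c) acX; apply: acX => // x /cY; apply/subsetP.
Qed.

Lemma forestP X :
  reflect (forall Y, Y \subset X -> mindeg2 Y -> Y = set0) (forest X).
Proof.
apply: (iffP idP) => [FX Y YX Y2 | noY].
  by apply/eqP; apply: contraLR FX => Y0; apply/forestPn; exists Y.
apply/negPn/negP => /forestPn[Y [YX Y2]].
by rewrite (noY Y YX Y2) eqxx.
Qed.

Lemma forestS X Y : X \subset Y -> forest Y -> forest X.
Proof.
move=> XY /forestP FY; apply/forestP => Z ZX; apply: FY.
exact: subset_trans XY.
Qed.

Lemma forest0 : forest (set0 : {set G}).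
Proof. by apply/forestP => Y; rewrite subset0 => /eqP. Qed.

Lemma triangle_not_forest X x y z :
  x \in X -> y \in X -> z \in X -> adj x y -> adj y z -> adj z x -> ~~ forest X.
Proof.
move=> xX yX zX xy yz zx; apply/forest_ucycleP.
move/(_ [:: x; y; z]); apply => //.
  by move=> v; rewrite !inE => /or3P[] /eqP->.
rewrite /ucycle /= xy yz zx !inE !andbT /= negb_or.
have neq u v : adj u v -> u != v.
  by apply: contraTneq => ->; rewrite adj_irr.
by rewrite !neq // adj_sym.
Qed.

(** Only opposite vertices are assumed distinct: consecutive ones differ by irreflexivity. *)
Lemma square_not_forest X x y z w :
  x \in X -> y \in X -> z \in X -> w \in X -> x != z -> y != w ->
  adj x y -> adj y z -> adj z w -> adj w x -> ~~ forest X.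
Proof.
move=> xX yX zX wX xz yw xy yz zw wx; apply/forest_ucycleP.
move/(_ [:: x; y; z; w]); apply => //.
  by move=> v; rewrite !inE => /or4P[] /eqP->.
rewrite /ucycle /= xy yz zw wx !inE !andbT /= !negb_or xz yw.
have neq u v : adj u v -> u != v.
  by apply: contraTneq => ->; rewrite adj_irr.
by rewrite !neq // adj_sym.
Qed.

(** Forests are closed under taking subsets, so testing single added vertices suffices. *)
Lemma max_forestP X :
  reflect (forest X /\ forall x, x \notin X -> ~~ forest (x |: X))
          (max_forest X).
Proof.
apply: (iffP maxsetP) => -[FX maxX]; split=> //.
  move=> x xX; apply: contraNN xX => /maxX <-; last exact: subsetUr.
  by rewrite setU11.
move=> Y FY XY; apply/eqP; rewrite eqEsubset XY andbT; apply/subsetP => y yY.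
apply: contraLR FY => /maxX; apply: contraNN; apply: forestS.
by rewrite subUset sub1set yY.
Qed.

(** * Independent sets and maximal forests *)

Lemma independentP X :
  reflect {in X &, forall x y, ~~ adj x y} (independent X).
Proof.
apply: (iffP forall_inP) => [indX x y xX yX | indX x xX].
  by have /forall_inP/(_ y yX) := indX x xX.
by apply/forall_inP => y; apply: indX.
Qed.

Lemma max_independent_adj X x : max_independent X -> x \notin X ->
  exists2 y, y \in X & adj x y.
Proof.
case/maxsetP=> /independentP indX maxX xX; apply/exists_inP.
apply: contraNT xX => /exists_inPn noy.
rewrite -(maxX (x |: X)) ?setU11 ?subsetUr //.
apply/independentP => u v /setU1P[->|uX] /setU1P[->|vX].
- by rewrite adj_irr.
- exact: noy.
- by rewrite adj_sym noy.
- exact: indX.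
Qed.

Lemma max_independent_neq0 X (x : G) :
  max_independent X -> exists y, y \in X.
Proof.
move=> mX; have [xX|/(max_independent_adj mX)[y yX _]] := boolP (x \in X).
  by exists x.
by exists y.
Qed.

Lemma independent_forest X : independent X -> forest X.
Proof.
move/independentP=> indX; apply/forestP => Y /subsetP YX /mindeg2P Y2.
apply/setP => y; rewrite inE; apply/negP => yY.
have [z [_ [zY _ _ yz _]]] := Y2 y yY.
by move: (indX _ _ (YX _ yY) (YX _ zY)); rewrite yz.
Qed.

(* Adding one vertex to an independent set only creates stars. *)
Lemma independentU1_forest X x : independent X -> forest (x |: X).
Proof.
move/independentP=> indX; apply/forestP => Y /subsetP YX /mindeg2P Y2.
have Yx y : y \in Y -> y = x.
  move=> yY; apply/eqP; apply: contraTT isT => yx.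
  have inX z : z \in Y -> z != x -> z \in X.
    by move=> /YX/setU1P[->|//]; rewrite eqxx.
  have [z1 [z2 [z1Y z2Y z12 yz1 yz2]]] := Y2 y yY.
  have nbx z : z \in Y -> adj y z -> z = x.
    move=> zY yz; apply/eqP; apply: contraLR yz => /(inX _ zY).
    exact/indX/inX.
  by rewrite (nbx z1) // (nbx z2) // eqxx in z12.
apply/setP => y; rewrite inE; apply/negP => yY.
have [z1 [_ [z1Y _ _ yz _]]] := Y2 y yY.
by rewrite (Yx _ yY) (Yx _ z1Y) adj_irr in yz.
Qed.

(** An independent set stays a forest when any vertex is added, so an independent maximal forest
    would contain all vertices, hence both ends of an edge. *)
Lemma max_forest_edge X : has_edge G -> max_forest X ->
  exists x y, [/\ x \in X, y \in X & adj x y].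
Proof.
move=> [a [b ab]] /max_forestP[_ maxX].
have [/independentP indX|] := boolP (independent X); last first.
  case/forall_inPn=> x xX /forall_inPn[y yX /negPn xy].
  by exists x, y.
have XT x : x \in X.
  apply: contraTT isT => /maxX; rewrite independentU1_forest //.
  exact/independentP.
by move: (indX a b (XT a) (XT b)); rewrite ab.
Qed.

End MinDegreeTwo.

Lemma imset_mindeg2 (G K : sgraph) (f : G -> K) (Y : {set G}) :
  injective f -> {homo f : x y / adj x y} ->
  mindeg2 Y -> mindeg2 (f @: Y).
Proof.
move=> f_inj f_adj /mindeg2P Y2; apply/mindeg2P => _ /imsetP[y yY ->].
have [z1 [z2 [z1Y z2Y z12 yz1 yz2]]] := Y2 y yY.
by exists (f z1), (f z2); rewrite !imset_f ?(inj_eq f_inj) ?f_adj.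
Qed.

(** Every set satisfying [P] extends to a maximal one. This serves both for forest numbers and for
    [alpha]. *)
Lemma bigmax_maxset (T : finType) (P : pred {set T}) (X : {set T}) :
  (forall Y Z, maxset P Y -> maxset P Z -> #|Y| = #|Z|) ->
  maxset P X -> \max_(Y : {set T} | P Y) #|Y| = #|X|.
Proof.
move=> eqP mX; apply/anti_leq/andP; split; last first.
  by apply: leq_bigmax_cond; apply: maxsetp mX.
apply/bigmax_leqP => Y PY; have [Z mZ YZ] := maxset_exists PY.
by rewrite (eqP X Z) // subset_leq_card.
Qed.

(** * Forests of the lexicographic product *)

Section LexForests.
Variables G H : sgraph.
Implicit Types (B : G -> {set H}) (A F T : {set G}).

Definition neighbours A x : {set G} := [set y in A | adj x y].

Definition blowup B : {set lex G H} := [set p | p.2 \in B p.1].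

Lemma card_blowup B : #|blowup B| = \sum_x #|B x|.
Proof.
rewrite -sum1_card (eq_bigr (fun x => \sum_(h in B x) 1)); last first.
  by move=> x _; rewrite sum1_card.
by rewrite pair_big_dep /=; apply: eq_bigl => p; rewrite inE.
Qed.

(** Let [Y] have minimum degree two in the blowup. Over an isolated vertex of [A] it would give such
    a set inside the forest [B x]. Over a fibre with several points, which is independent, all
    neighbours lie in one fibre of size at most one, so degree two is impossible. Hence [Y] only
    meets singleton fibres and projects to a set of minimum degree two in [A]. *)
Lemma blowup_forest A B :
  forest A ->
  (forall x h, h \in B x -> x \in A) ->
  (forall x, neighbours A x = set0 -> forest (B x)) ->
  (forall x, neighbours A x != set0 -> 1 < #|B x| -> independent (B x) /\
     exists y, forall z, z \in neighbours A x -> z = y /\ #|B z| <= 1) ->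
  forest (blowup B).
Proof.
move=> /forestP FA BA Biso Bbig; apply/forestP => Y /subsetP YB /mindeg2P Y2.
have {}YB x h : (x, h) \in Y -> h \in B x by move/YB; rewrite inE.
have Yniso x h : (x, h) \in Y -> neighbours A x != set0.
  move=> xhY; apply/negP => /eqP iso_x.
  have nadj z k : (z, k) \in Y -> ~~ adj x z.
    move=> /YB/BA zA; apply/negP => xz.
    by move/setP/(_ z): iso_x; rewrite !inE zA xz.
  have /forestP/(_ [set k | (x, k) \in Y]) := Biso x iso_x.
  move=> /(_ _ _)/setP Y0.
  have : h \in [set k | (x, k) \in Y] by rewrite inE.
  rewrite Y0 ?inE //; first by apply/subsetP => k; rewrite inE; apply: YB.
  apply/mindeg2P => k; rewrite inE => xkY.
  have [[z1 k1] [[z2 k2] [z1Y z2Y z12]]] := Y2 _ xkY.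
  rewrite /= /lex_adj /= (negbTE (nadj _ _ z1Y)) (negbTE (nadj _ _ z2Y)) /=.
  move=> /andP[/eqP xz1 kk1] /andP[/eqP xz2 kk2]; exists k1, k2.
  rewrite -xz1 -xz2 in z1Y z2Y z12; rewrite !inE; split=> //.
  by apply: contraNneq z12 => ->.
have Bsmall x h : (x, h) \in Y -> #|B x| <= 1.
  move=> xhY; rewrite leqNgt; apply/negP => /(Bbig x (Yniso _ _ xhY)).
  move=> [/independentP indB [y xy]].
  have nb z k : (z, k) \in Y -> lex_adj (x, h) (z, k) ->
      z \in neighbours A x.
    move=> zkY /orP[/= xz|/andP[/= /eqP xz hk]].
      by rewrite inE (BA z k (YB _ _ zkY)).
    rewrite -xz in zkY.
    by move: (indB h k (YB _ _ xhY) (YB _ _ zkY)); rewrite hk.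
  have [[z1 k1] [[z2 k2] [z1Y z2Y z12 a1 a2]]] := Y2 _ xhY.
  have [E1 Bz1] := xy _ (nb _ _ z1Y a1); have [E2 _] := xy _ (nb _ _ z2Y a2).
  rewrite {}E1 {}E2 in z1Y z2Y z12 Bz1.
  by rewrite (card_le1_eqP Bz1 _ _ (YB _ _ z1Y) (YB _ _ z2Y)) eqxx in z12.
have /setP Y0 : fst @: Y = set0.
  apply: FA; first by apply/subsetP => _ /imsetP[[x h] /YB/BA xA ->].
  apply/mindeg2P => _ /imsetP[[x h] xhY ->].
  have adjE z k : (z, k) \in Y -> lex_adj (x, h) (z, k) -> adj x z.
    move=> zkY /orP[//|/andP[/= /eqP xz hk]]; rewrite -xz in zkY.
    have /card_le1_eqP Bx := Bsmall _ _ xhY.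
    by move: hk; rewrite (Bx _ _ (YB _ _ xhY) (YB _ _ zkY)) adj_irr.
  have [[z1 k1] [[z2 k2] [z1Y z2Y z12 a1 a2]]] := Y2 _ xhY.
  exists z1, z2; split.
  - by apply/imsetP; exists (z1, k1).
  - by apply/imsetP; exists (z2, k2).
  - apply: contraNneq z12 => zE; rewrite -zE in z2Y *.
    by rewrite (card_le1_eqP (Bsmall _ _ z1Y) _ _ (YB _ _ z1Y) (YB _ _ z2Y)).
  - exact: adjE z1Y a1.
  - exact: adjE z2Y a2.
apply/setP => p; rewrite inE; apply/negP => pY.
by have := Y0 p.1; rewrite imset_f // inE.
Qed.

Lemma fibre_not_forest (X : {set lex G H}) x (Z : {set H}) :
  ~~ forest Z -> {in Z, forall h, (x, h) \in X} -> ~~ forest X.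
Proof.
move=> /forestPn[Y [/subsetP YZ Y2 Y0]] ZX; apply/forestPn.
exists ((fun h => (x, h) : lex G H) @: Y); split.
- by apply/subsetP => _ /imsetP[h /YZ/ZX hX ->].
- apply: imset_mindeg2 Y2 => [h k []//|h k hk].
  by rewrite /= /lex_adj /= eqxx hk orbT.
- have /set0Pn[h hY] := Y0; apply/set0Pn; exists (x, h).
  by apply/imsetP; exists h.
Qed.

(** Whatever [s] is, the map sending [x] to [(x, s x)] is injective and preserves edges. *)
Lemma section_not_forest (X : {set lex G H}) (s : G -> H) (Z : {set G}) :
  ~~ forest Z -> {in Z, forall x, (x, s x) \in X} -> ~~ forest X.
Proof.
move=> /forestPn[Y [/subsetP YZ Y2 Y0]] ZX; apply/forestPn.
exists ((fun x => (x, s x) : lex G H) @: Y); split.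
- by apply/subsetP => _ /imsetP[h /YZ/ZX hX ->].
- apply: imset_mindeg2 Y2 => [x y []//|x y xy].
  by rewrite /= /lex_adj /= xy.
- have /set0Pn[x xY] := Y0; apply/set0Pn; exists (x, s x).
  by apply/imsetP; exists x.
Qed.

(** A point added over [A] spoils the maximal forest in its fibre. A point added elsewhere is
    adjacent to a whole copy of [FH], and an edge of that copy closes a triangle. *)
Lemma blowup_independent_max_forest A (FH : {set H}) :
  has_edge H -> max_independent A -> max_forest FH ->
  max_forest (blowup (fun x => if x \in A then FH else set0)).
Proof.
move=> edgeH mA mFH; have [FFH maxFH] := max_forestP _ mFH.
have indA : independent A by apply: maxsetp mA.
apply/max_forestP; split.
  apply: (@blowup_forest A) => [|x h|x _|x].
  - exact: independent_forest.
  - by case: ifP => //; rewrite inE.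
  - by case: ifP => // _; apply: forest0.
  - case/set0Pn=> y; rewrite inE => /andP[yA xy]; case: ifP => [xA|]; last first.
      by rewrite cards0.
    by move/independentP/(_ x y xA yA): indA; rewrite xy.
move=> [x h]; rewrite inE /=; have [xA hFH|xA _] := boolP (x \in A).
  apply: (@fibre_not_forest _ x _ (maxFH h hFH)) => k /setU1P[->|kFH].
    by rewrite setU11.
  by rewrite !inE /= xA kFH orbT.
have [y yA xy] := max_independent_adj mA xA.
have [a [b [aF bF ab]]] := max_forest_edge edgeH mFH.
apply: (@triangle_not_forest (lex G H) _ (x, h) (y, a) (y, b)).
- by rewrite setU11.
- by rewrite !inE /= yA aF orbT.
- by rewrite !inE /= yA bF orbT.
- by rewrite /= /lex_adj /= xy.
- by rewrite /= /lex_adj /= eqxx ab orbT.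
- by rewrite /= /lex_adj /= adj_sym xy.
Qed.

(** In the application, [T] consists of all leaves of [F] outside the K2 components and one leaf of
    each K2 component. *)
Definition fibre F T (FH M : {set H}) h0 x : {set H} :=
  if x \notin F then set0 else
  if neighbours F x == set0 then FH else
  if x \in T then M else [set h0].

(* Taking h0 in M matters when #|M| = 1: then h0 is adjacent to all other
   vertices of H, so nothing can be added to the fibre [set h0] of a K2. *)
Lemma blowup_fibre_max_forest F T (FH M : {set H}) h0 :
  max_forest F -> T \subset F ->
  {in T, forall x, #|neighbours F x| = 1} -> independent T ->
  (forall x, x \in F -> #|neighbours F x| = 1 -> x \notin T ->
     exists2 y, y \in T & adj x y) ->
  has_edge H -> max_forest FH -> max_independent M -> h0 \in M ->
  max_forest (blowup (fibre F T FH M h0)).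
Proof.
move=> mF /subsetP TF T1 /independentP indT nT edgeH mFH mM h0M.
have [FFH maxFH] := max_forestP _ mFH; have [FF maxF] := max_forestP _ mF.
have indM : independent M by apply: maxsetp mM.
have [h1 [_ [h1F _ _]]] := max_forest_edge edgeH mFH.
(* A section of the blowup over [F]: [h1] lies in [FH], and [h0] lies both in [M] and in
   [[set h0]]. *)
pose s x := if neighbours F x == set0 then h1 else h0.
have sB x : x \in F -> s x \in fibre F T FH M h0 x.
  by rewrite /s /fibre => ->; case: ifP => //; case: ifP => //; rewrite !inE.
apply/max_forestP; split.
  apply: (@blowup_forest F) => [//|x h|x iso_x|x niso_x].
  - by rewrite /fibre; case: (x \in F) => //; rewrite inE.
  - by rewrite /fibre iso_x eqxx; case: ifP => // _; apply: forest0.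
  - rewrite /fibre (negbTE niso_x); case: ifP => [|_]; first by rewrite cards0.
    case: ifP => [xT _|_]; last by rewrite cards1.
    split=> //; have /eqP/cards1P[y yE] := T1 x xT; exists y => z.
    rewrite yE => /set1P->; split=> //.
    have : y \in neighbours F x by rewrite yE set11.
    rewrite inE => /andP[yF xy]; rewrite yF /=.
    have /negbTE-> : neighbours F y != set0.
      by apply/set0Pn; exists x; rewrite inE TF // adj_sym.
    case: ifP => [yT|_]; last by rewrite cards1.
    by move: (indT x y xT yT); rewrite xy.
set X := blowup _ => -[x h]; rewrite inE /= => hB.
have inX y k : k \in fibre F T FH M h0 y -> ((y, k) : lex G H) \in (x, h) |: X.
  by move=> kB; rewrite !inE /= kB orbT.
have xhX : ((x, h) : lex G H) \in (x, h) |: X by rewrite setU11.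
have [xF|xF] := boolP (x \in F); last first.
  (* The section, given the value [h] at [x], carries a copy of the non-forest [x |: F]. *)
  apply: (@section_not_forest _ (fun y => if y == x then h else s y) _ (maxF x xF)).
  move=> y /setU1P[->|yF]; first by rewrite eqxx.
  by case: eqP => [->//|_]; apply/inX/sB.
have [iso_x|niso_x] := eqVneq (neighbours F x) set0.
  move: hB; rewrite /fibre xF iso_x eqxx /= => hFH.
  apply: (@fibre_not_forest _ x _ (maxFH h hFH)) => k /setU1P[->//|kFH].
  by apply: inX; rewrite /fibre xF iso_x eqxx.
have sx : s x = h0 by rewrite /s (negbTE niso_x).
have hs : h != s x by apply: contraNneq hB => ->; apply: sB.
have adjD y k z : adj y z -> forall l, @adj (lex G H) (y, k) (z, l).
  by move=> yz l; rewrite /= /lex_adj /= yz.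
have triangle y k l : adj x y -> l \in fibre F T FH M h0 y -> adj h k ->
    k \in fibre F T FH M h0 x -> ~~ @forest (lex G H) ((x, h) |: X).
  move=> xy lB hk kB.
  apply: (@triangle_not_forest (lex G H) _ (x, h) (x, k) (y, l)).
  - by [].
  - exact: inX.
  - exact: inX.
  - by rewrite /= /lex_adj /= eqxx hk orbT.
  - exact: adjD.
  - by apply: adjD; rewrite adj_sym.
have square y k z l : adj x y -> adj x z -> k \in fibre F T FH M h0 y ->
    l \in fibre F T FH M h0 z -> (y, k) != (z, l) -> ~~ @forest (lex G H) ((x, h) |: X).
  move=> xy xz kB lB ykzl.
  apply: (@square_not_forest (lex G H) _ (x, h) (y, k) (x, s x) (z, l)) => //.
  - exact: inX.
  - exact/inX/sB.
  - exact: inX.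
  - by apply: contraNneq hs => -[->].
  - exact: adjD.
  - by apply: adjD; rewrite adj_sym.
  - exact: adjD.
  - by apply: adjD; rewrite adj_sym.
(* Over [T] the fibre is [M], so [h] has a neighbour in it; any point over a neighbour of [x]
   completes a triangle. *)
have [xT|xT] := boolP (x \in T).
  have BxE : fibre F T FH M h0 x = M by rewrite /fibre xF (negbTE niso_x) xT.
  rewrite BxE in hB.
  have [k kM hk] := max_independent_adj mM hB.
  have /set0Pn[y] := niso_x; rewrite inE => /andP[yF xy].
  by apply: (triangle y k (s y)) => //; [apply: sB | rewrite BxE].
(* With two neighbours of [x] in [F], the points [h] and [s x] over [x] are opposite corners of a
   square. *)
have [/card_gt1P[y [z [yN zN yz]]]|] := ltnP 1 #|neighbours F x|.
  move: yN zN; rewrite !inE => /andP[yF xy] /andP[zF xz].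
  apply: (square y (s y) z (s z)) => //; try exact: sB.
  by apply: contraNneq yz => -[->].
rewrite -card_gt0 in niso_x => N1.
(* There remains a leaf [x] outside [T]; its neighbour [y] in [T] carries [M]. Two points of [M]
   give a square, and a single one gives a triangle. *)
have [y yT xy] := nT x xF (anti_leq (introT andP (conj N1 niso_x))) xT.
have ByE : fibre F T FH M h0 y = M.
  rewrite /fibre TF // yT; case: eqP => // iso_y.
  by have := T1 y yT; rewrite iso_y cards0.
have [/card_gt1P[k [l [kM lM kl]]]|/card_le1_eqP M1] := ltnP 1 #|M|.
  by apply: (square y k y l); rewrite ?ByE //; apply: contraNneq kl => -[->].
have hM : h \notin M.
  by apply: contraNN hs => hM; rewrite sx (M1 h h0).
have [k kM hk] := max_independent_adj mM hM.
apply: (triangle y h0 h0); rewrite ?ByE //; first by rewrite (M1 k h0).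
by have := sB x xF; rewrite sx.
Qed.

(** The sizes are compared vertex by vertex; vertices of [T] have a neighbour in [F], so the three
    classes are disjoint. *)
Lemma card_blowup_fibre F T (FH M : {set H}) h0 : T \subset F ->
  {in T, forall x, #|neighbours F x| = 1} ->
  #|blowup (fibre F T FH M h0)| =
    #|FH| * #|[set x in F | neighbours F x == set0]| + #|M| * #|T|
    + #|[set x in F | (neighbours F x != set0) && (x \notin T)]|.
Proof.
move=> /subsetP TF T1; rewrite card_blowup.
have card_sum (A : {set G}) : #|A| = \sum_x (x \in A : nat).
  by rewrite -sum1_card big_mkcond.
rewrite !(card_sum [set _ in _ | _]) (card_sum T) !big_distrr -!big_split /=.
apply: eq_bigr => x _; rewrite /fibre !inE.
have [xF|xF] := boolP (x \in F); last first.
  by rewrite (negbTE (contraNN (@TF x) xF)) /= cards0 !muln0.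
have [xT|xT] := boolP (x \in T); last first.
  by case: eqP => _ /=; rewrite ?cards1 ?muln0 ?muln1 ?addn0 ?addn1.
have /negbTE-> : neighbours F x != set0 by rewrite -card_gt0 T1.
by rewrite /= muln0 muln1 addn0.
Qed.

End LexForests.

(** * Leaves and K2 components *)

Section Leaves.
Variable D : sgraph.
Implicit Types x y z : D.

(** A local criterion for lying in a K2 component, justified by [is_K2_component], which replaces
    isomorphisms in the counting. *)
Definition k2_vertex x := leaf x && [exists y, adj x y && leaf y].

Lemma leaf_adj_inj x y z : leaf x -> adj x y -> adj x z -> y = z.
Proof.
case/cards1P=> w E xy xz.
have : y \in [set w] by rewrite -E inE.
have : z \in [set w] by rewrite -E inE.
by move=> /set1P-> /set1P->.
Qed.

Lemma adj_connect_sym : connect_sym (@adj D).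
Proof. exact/sym_connect_sym/adj_sym. Qed.

Lemma k2_component x y :
  leaf x -> leaf y -> adj x y -> component x = [set x; y].
Proof.
move=> lx ly xy; have yx : adj y x by rewrite adj_sym.
apply/setP => z; rewrite inE; apply/idP/idP => [xz|]; last first.
  by case/set2P=> ->; [apply: connect0 | apply: connect1].
(* Each of the two leaves has the other as its only neighbour, so the pair is closed under
   adjacency. *)
have cl : closed (@adj D) [set x; y].
  apply: (intro_closed adj_connect_sym) => u v uv /set2P[] uE.
    by rewrite uE in uv; rewrite (leaf_adj_inj lx uv xy) set22.
  by rewrite uE in uv; rewrite (leaf_adj_inj ly uv yx) set21.
by rewrite -(closed_connect cl xz) set21.
Qed.

Lemma is_K2_component x : is_K2 (component x) = k2_vertex x.
Proof.
apply/idP/idP => [/existsP[f /and3P[/injectiveP f_inj /forallP f_onto]]|].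
  move=> /forallP f_adj.
  have xC : x \in component x by rewrite inE connect0.
  have C2 : #|component x| == 2.
    rewrite -card_sig -(card_ord 2) -(card_codom f_inj); apply/eqP.
    by apply: eq_card => i; rewrite !inE f_onto.
  have [y [xy CE]] : exists y, x != y /\ component x = [set x; y].
    have /cards2P[a [b [ab CE]]] := C2; rewrite CE in xC.
    case/set2P: xC => E; first by exists b; rewrite CE E.
    by exists a; rewrite CE E setUC eq_sym.
  have yC : y \in component x by rewrite CE set22.
  have adjxy : adj x y.
    have /forallP/(_ (Sub y yC))/eqP/esym fE := f_adj (Sub x xC).
    apply: (etrans fE); rewrite /= /complete_adj (inj_eq f_inj).
    by apply: contraNneq xy => /(congr1 val) /= ->.
  have nbrs u v : u \in component x -> adj u v -> v \in component x.
    by rewrite !inE => xu uv; apply: connect_trans xu (connect1 uv).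
  (* Neighbours stay in the component, so in a component of two vertices the only possible neighbour
     is the other vertex. *)
  have lf u v : adj u v -> component x = [set u; v] -> leaf u.
    move=> uv CuE; apply/cards1P; exists v; apply/setP => w; rewrite !inE.
    apply/idP/eqP => [uw|->//].
    have : w \in component x by apply: nbrs uw; rewrite CuE set21.
    rewrite CuE => /set2P[] // wu; by rewrite wu adj_irr in uw.
  apply/andP; split; first exact: lf adjxy CE.
  apply/existsP; exists y; rewrite adjxy; apply: (lf y x).
    by rewrite adj_sym.
  by rewrite setUC.
case/andP=> lx /existsP[y /andP[xy ly]].
have CE := k2_component lx ly xy.
have yx : adj y x by rewrite adj_sym.
have yNx : (y == x) = false.
  by apply: contraTF xy => /eqP->; rewrite adj_irr.
have xC : x \in component x by rewrite CE set21.
have yC : y \in component x by rewrite CE set22.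
apply/existsP; exists [ffun u : induced (component x) =>
  if val u == x then ord0 else ord_max : 'I_2].
have Cxy (u : induced (component x)) : (val u == x) || (val u == y).
  by case: u => u uC /=; move: (uC); rewrite {1}CE !inE.
apply/and3P; split.
- apply/injectiveP => u v; rewrite !ffunE => uv; apply: val_inj; move: uv.
  by case/orP: (Cxy u) => /eqP->; case/orP: (Cxy v) => /eqP->;
    rewrite ?eqxx ?yNx.
- apply/forallP => -[[|[|i]] i2] //; apply/codomP.
    by exists (Sub x xC); apply: val_inj; rewrite ffunE /= eqxx.
  exists (Sub y yC); apply: val_inj.
  by rewrite ffunE /= yNx.
- apply/forallP => u; apply/forallP => v; apply/eqP.
  rewrite !ffunE -[RHS]/(adj (val u) (val v)) -[LHS]/(_ != _).
  case/orP: (Cxy u) => /eqP->; case/orP: (Cxy v) => /eqP->;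
    by rewrite ?eqxx ?yNx ?adj_irr ?xy ?yx.
Qed.

Lemma k2_vertex_partner x : k2_vertex x ->
  exists y, [/\ adj x y, k2_vertex y, component x = [set x; y]
              & root (@adj D) x = root (@adj D) y].
Proof.
case/andP=> lx /existsP[y /andP[xy ly]]; exists y; split=> //.
- by rewrite /k2_vertex ly; apply/existsP; exists x; rewrite adj_sym xy.
- exact: k2_component.
- by apply/(rootP adj_connect_sym)/connect1.
Qed.

(* Each K2 component contains exactly one vertex that is its own root and
   exactly one that is not. *)
Lemma card_k2_root (b : bool) :
  #|[set x | k2_vertex x && ((root (@adj D) x == x) == b)]| = num_K2 D.
Proof.
rewrite -(@card_in_imset _ _ (@component D)); last first.
  move=> x y; rewrite !inE => /andP[kx /eqP rx] /andP[ky /eqP ry] xy.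
  have [z [_ _ CE rE]] := k2_vertex_partner kx.
  have yC : y \in component x by rewrite xy inE connect0.
  have rC : root (@adj D) x \in component x by rewrite inE connect_root.
  have /(rootP adj_connect_sym) rxy : connect (@adj D) x y by rewrite inE in yC.
  (* If [y] were the other vertex of the component, exactly one of [x] and [y] would be the common
     root, whereas both have the same status [b]. *)
  move: yC rC; rewrite CE => /set2P[->//|yz] /set2P[] E.
    by move: ry; rewrite -rx -rxy E eqxx => /eqP.
  by move: rx; rewrite -ry -rxy E -yz eqxx => /eqP.
congr #|pred_of_set _|; apply/setP => C; rewrite inE.
apply/imsetP/andP => [[x]|[/imsetP[x _ ->]]].
  by rewrite inE => /andP[kx _] ->; rewrite is_K2_component kx imset_f.
rewrite is_K2_component => kx; have [z [xz kz CE rE]] := k2_vertex_partner kx.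
have xNz : x != z by apply: contraTneq xz => ->; rewrite adj_irr.
have Cz : component x = component z.
  apply/setP => w; rewrite !inE.
  exact: (same_connect adj_connect_sym (connect1 xz)).
have rC : root (@adj D) x \in component x by rewrite inE connect_root.
have [rx|rx] := eqVneq (root (@adj D) x == x) b.
  by exists x => //; rewrite inE kx rx eqxx.
exists z => //; rewrite inE kz -rE.
move: rC rx; rewrite CE => /set2P[] ->; rewrite eqxx.
  by case: b => //; rewrite (negbTE xNz).
by rewrite [z == x]eq_sym (negbTE xNz); case: b.
Qed.

(** The canonical [root] chooses one of the two leaves of each K2 component; all other leaves are
    kept. *)
Definition selected_leaves : {set D} :=
  [set x | leaf x && (~~ k2_vertex x || (root (@adj D) x == x))].

(** Adjacent leaves form a K2 component; if both were selected, both would be its root. *)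
Lemma selected_leaves_independent : independent selected_leaves.
Proof.
apply/independentP => x y; rewrite !inE => /andP[lx kx] /andP[ly ky].
apply/negP => xy; have yx : adj y x by rewrite adj_sym.
have k u v : leaf u -> leaf v -> adj u v -> k2_vertex u.
  by move=> lu lv uv; rewrite /k2_vertex lu; apply/existsP; exists v; rewrite uv.
move: kx ky; rewrite (k x y) // (k y x) //= => /eqP rx /eqP ry.
have /(rootP adj_connect_sym) := connect1 xy.
by rewrite rx ry => E; rewrite E adj_irr in xy.
Qed.

Lemma unselected_leaf x : leaf x -> x \notin selected_leaves ->
  exists2 y, y \in selected_leaves & adj x y.
Proof.
move=> lx; rewrite inE lx /= negb_or negbK => /andP[kx rx].
have [y [xy ky CE rE]] := k2_vertex_partner kx; exists y => //.
have : root (@adj D) x \in component x by rewrite inE connect_root.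
rewrite CE !inE (negbTE rx) /= => /eqP ry.
by rewrite -rE ry eqxx orbT andbT; case/andP: ky.
Qed.

Lemma card_selected_leaves : #|selected_leaves| = num_K2 D + num_leaves D.
Proof.
rewrite -(card_k2_root true) -(cardsID [set x | k2_vertex x]).
congr (_ + _); apply: eq_card => x; rewrite !inE ?is_K2_component /k2_vertex.
  by case: leaf; case: existsP => //=; rewrite ?andbF ?andbT // eqb_id.
by case: leaf; case: existsP => //=; rewrite ?andbF ?andbT.
Qed.

(** The leaves counted here are the non-root vertices of the K2 components, one for each; the other
    vertices have degree at least two. *)
Lemma card_unselected :
  #|[set x | ~~ isolated x && (x \notin selected_leaves)]|
  = num_K2 D + num_inner D.
Proof.
rewrite -(card_k2_root false) -(cardsID [set x | leaf x]).
congr (_ + _); apply: eq_card => x; rewrite !inE /k2_vertex /isolated /leaf.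
  case: (degree x) => [|[|n]] //=.
  by rewrite andbT negb_or negbK eqbF_neg.
by case: (degree x) => [|[|n]].
Qed.

Lemma num_vertices :
  #|D| = num_isolated D + #|selected_leaves| + (num_K2 D + num_inner D).
Proof.
rewrite -card_unselected -cardsT -(cardsID [set x | isolated x]) -addnA.
congr (_ + _); first by apply: eq_card => x; rewrite !inE.
rewrite -(cardsID selected_leaves).
congr (_ + _); apply: eq_card => x; rewrite !inE /isolated /leaf.
  by case: degree => [|n] //=; rewrite ?andbF.
by rewrite andbT andbC.
Qed.

End Leaves.

(** * Transfer to induced forests and comparison of cardinals *)

Lemma card_induced (G : sgraph) (F : {set G}) (P : pred G) :
  #|[set x : induced F | P (val x)]| = #|[set x in F | P x]|.
Proof.
rewrite -(card_imset _ val_inj); apply: eq_card => y; rewrite !inE.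
apply/imsetP/andP => [[x]|[yF Py]].
  by rewrite inE => Px ->; split=> //; apply: (valP x).
by exists (Sub y yF); rewrite ?inE.
Qed.

Lemma degree_induced (G : sgraph) (F : {set G}) (x : induced F) :
  degree x = #|neighbours F (val x)|.
Proof. exact: card_induced. Qed.

Lemma isolated_induced (G : sgraph) (F : {set G}) (x : induced F) :
  isolated x = (neighbours F (val x) == set0).
Proof. by rewrite /isolated degree_induced cards_eq0. Qed.

(** With the selected leaves as [T], each K2 component is counted twice: one leaf carries [M], the
    other a single point. *)
Lemma max_forest_of_lex (G H : sgraph) (F : {set G}) (FH M : {set H}) :
  has_edge H -> max_forest F -> max_forest FH -> max_independent M ->
  exists2 X : {set lex G H}, max_forest X &
    #|X| = #|FH| * num_isolated (induced F)
           + #|M| * (num_K2 (induced F) + num_leaves (induced F))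
           + (num_K2 (induced F) + num_inner (induced F)).
Proof.
move=> edgeH mF mFH mM; have [a _] := edgeH.
have [h0 h0M] := max_independent_neq0 a mM.
pose T := val @: selected_leaves (induced F).
have memT (x : induced F) : (val x \in T) = (x \in selected_leaves (induced F)).
  by rewrite mem_imset //; apply: val_inj.
have TF : T \subset F by apply/subsetP => _ /imsetP[x _ ->]; apply: (valP x).
have T1 : {in T, forall x, #|neighbours F x| = 1}.
  move=> _ /imsetP[x xS ->]; rewrite -degree_induced.
  by move: xS; rewrite inE => /andP[/eqP].
exists (blowup (fibre F T FH M h0)).
  apply: blowup_fibre_max_forest => //.
    apply/independentP => _ _ /imsetP[x xS ->] /imsetP[y yS ->].
    by have /independentP/(_ x y xS yS) := selected_leaves_independent (induced F).
  move=> x xF x1; rewrite -[x]/(val (Sub x xF : induced F)) memT => xS.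
  have lx : leaf (Sub x xF : induced F) by rewrite /leaf degree_induced x1.
  have [y yS xy] := unselected_leaf lx xS.
  by exists (val y); rewrite ?memT.
rewrite card_blowup_fibre // -card_unselected -card_selected_leaves.
rewrite (card_imset _ val_inj) -!card_induced; congr (_ * _ + _ + _).
  by apply: eq_card => x; rewrite !inE isolated_induced.
by apply: eq_card => x; rewrite !inE isolated_induced memT inE.
Qed.

Theorem theorem3p5 (G H : sgraph) (edgeG : has_edge G) (edgeH : has_edge H)
    (wfc : well_f_covered (lex G H)) :
  [/\
      well_covered G /\
      ((forall F : {set G}, max_forest F ->
          forall x : induced F, ~~ isolated x) ->
       (exists M : {set H}, max_independent M /\ #|M| = 1) ->
       well_f_covered G /\ forest_number G = forest_number (lex G H)),
      well_f_covered H /\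
      ((exists F : {set G}, max_forest F /\ exists x : induced F, leaf x) ->
       well_covered H),
      forest_number (lex G H) = alpha G * forest_number H
    &
      forall (F : {set G}) (M : {set H}), max_forest F -> max_independent M ->
        forest_number H * num_isolated (induced F)
        + #|M| * (num_K2 (induced F) + num_leaves (induced F))
        + num_K2 (induced F) + num_inner (induced F)
        = forest_number (lex G H)].
Proof.
have [FH0 mFH0 _] := maxset_exists (forest0 H).
have [F0 mF0 _] := maxset_exists (forest0 G).
have ind0 (K : sgraph) : independent (set0 : {set K}).
  by apply/independentP => x y; rewrite inE.
have [A0 mA0 _] := maxset_exists (ind0 G).
have fnE (X : {set lex G H}) : max_forest X -> forest_number (lex G H) = #|X|.
  exact: (bigmax_maxset wfc).
have prodE (A : {set G}) (FH : {set H}) : max_independent A -> max_forest FH ->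
    forest_number (lex G H) = #|A| * #|FH|.
  move=> mA mFH; rewrite (fnE _ (blowup_independent_max_forest edgeH mA mFH)).
  rewrite card_blowup (eq_bigr (fun x => if x \in A then #|FH| else 0)).
    by rewrite -big_mkcond sum_nat_const.
  by move=> x _; case: ifP => // _; rewrite cards0.
(* The edges of [G] and [H] make both factors of the product formula positive, so either can be
   cancelled. *)
have FH0_gt0 : 0 < #|FH0|.
  have [x [_ [xF _ _]]] := max_forest_edge edgeH mFH0.
  by apply/card_gt0P; exists x.
have A0_gt0 : 0 < #|A0|.
  have [a _] := edgeG; have [x xA] := max_independent_neq0 a mA0.
  by apply/card_gt0P; exists x.
have wcG : well_covered G.
  move=> A B mA mB; apply/eqP; rewrite -(eqn_pmul2r FH0_gt0).
  by rewrite -(prodE A) // -(prodE B).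
have wfH : well_f_covered H.
  move=> A B mA mB; apply/eqP; rewrite -(eqn_pmul2l A0_gt0).
  by rewrite -(prodE A0 A) // -(prodE A0 B).
have fHE : forest_number H = #|FH0| by apply: (bigmax_maxset wfH).
have formula (F : {set G}) (M : {set H}) : max_forest F -> max_independent M ->
    forest_number H * num_isolated (induced F)
    + #|M| * (num_K2 (induced F) + num_leaves (induced F))
    + (num_K2 (induced F) + num_inner (induced F)) = forest_number (lex G H).
  move=> mF mM; have [X mX XE] := max_forest_of_lex edgeH mF mFH0 mM.
  by rewrite fHE -XE (fnE X).
split.
- split=> // noiso [M [mM M1]].
  (* Without isolated vertices and with [#|M| = 1], the formula counts each vertex of [F] once. *)
  have cardF (F : {set G}) : max_forest F -> #|F| = forest_number (lex G H).
    move=> mF; have iso0 : num_isolated (induced F) = 0.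
      apply/eqP; rewrite cards_eq0; apply/eqP/setP => x.
      by rewrite !inE; apply/negbTE/noiso.
    rewrite -(formula F M) // M1 mul1n -card_selected_leaves iso0 muln0.
    by have := num_vertices (induced F); rewrite card_sig iso0 => ->.
  have wfG : well_f_covered G by move=> X Y mX mY; rewrite !cardF.
  by split=> //; rewrite -(cardF F0 mF0); apply: (bigmax_maxset wfG).
- split=> // -[F [mF [x lx]]] M N mM mN.
  (* This is the coefficient of [#|M|] in the formula. It is positive because a leaf is selected or
     adjacent to a selected one, so comparing [M] and [N] over the same [F] gives equal sizes. *)
  have S_gt0 : 0 < num_K2 (induced F) + num_leaves (induced F).
    rewrite -card_selected_leaves; apply/card_gt0P.
    have [xS|xS] := boolP (x \in selected_leaves (induced F)); first by exists x.
    by have [y yS _] := unselected_leaf lx xS; exists y.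
  have /eqP := etrans (formula F M mF mM) (esym (formula F N mF mN)).
  by rewrite eqn_add2r eqn_add2l eqn_pmul2r // => /eqP.
- by rewrite fHE (prodE A0 FH0) //; congr (_ * _); apply/esym/(bigmax_maxset wcG).
- by move=> F M mF mM; rewrite -addnA formula.
Qed.
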